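(* Let $R$ be a commutative noetherian ring, let $I,\mathfrak{a}\subset R$ be ideals of positive height, and let $t\in\mathbb{R}_{>0}$. (a) If $t>1$, then $\overline{I}^{\mathfrak{a}^t}\subset\left(\overline{I}^{\mathfrak{a}^{t-1}}:\mathfrak{a}\right)$, and equality holds if $\mathfrak{a}$ is a principal ideal or $t\in\mathbb{Z}$. (b) If $t\in\mathbb{Q}_{>0}$, then $\overline{I}^{\mathfrak{a}^t}\subset(\overline{I}:\mathfrak{a}_t)\subset\overline{I}^{\mathfrak{a}^{\lceil t\rceil}}$, where $\mathfrak{a}_t$ is the $t$-th rational power of $\mathfrak{a}$. (c) If $t\in\mathbb{Z}_{\ge 1}$, then $\overline{I}^{\mathfrak{a}^t}=(\overline{I}:\mathfrak{a}^t)$.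
   Context: All rings are commutative with unit and noetherian. $R^\circ$ is the set of elements of $R$ not in any minimal prime of $R$. An ideal has positive height if it is not contained in any minimal prime. $\overline{I}$ is the usual integral closure of $I$. For ideals $I,\mathfrak{a}\subset R$ and $t\in\mathbb{R}_{>0}$ the (Hara-Yoshida) $\mathfrak{a}^t$-integral closure is $$\overline{I}^{\mathfrak{a}^t}=\{x\in R\mid \text{for some } c\in R^\circ \text{ and all } n\gg 0,\ cx^n\mathfrak{a}^{\lceil tn\rceil}\subset I^n\}.$$ In $\overline{I}^{\mathfrak{a}^{t-1}}$ and $\overline{I}^{\mathfrak{a}^{\lceil t\rceil}}$ the ideal is $\mathfrak{a}$ and the real parameter is $t-1$, respectively $\lceil t\rceil$. For $t=r/s\in\mathbb{Q}_{\ge0}$ ($r,s$ integers, $r\ge 0$, $s>0$) the $t$-th rational power of $\mathfrak{a}$ is $\mathfrak{a}_t=\{x\in R\mid x^s\in\overline{\mathfrak{a}^r}\}$. The symbol $\subset$ allows equality. *)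

(* Defs.v *)
From mathcomp Require Import all_boot all_order all_algebra.
From mathcomp Require Import boolp classical_sets reals.

Set Implicit Arguments.
Unset Strict Implicit.
Unset Printing Implicit Defensive.

Import Order.TTheory GRing.Theory Num.Theory.
Local Open Scope classical_set_scope.
Local Open Scope ring_scope.

Section Ideals.
Variable R : comPzRingType.
Implicit Types (I J P : set R).

(* The [idealr] structures of [ring_quotient] are decidable and proper, whereas
   the unit ideal must be allowed here. *)
Definition is_ideal I : Prop :=
  [/\ I 0, forall x y, I x -> I y -> I (x + y) & forall a x, I x -> I (a * x)].

Definition is_prime_ideal P : Prop :=
  [/\ is_ideal P, ~ P 1 & forall x y, P (x * y) -> P x \/ P y].

Definition is_minimal_prime P : Prop :=
  is_prime_ideal P /\ forall Q : set R, is_prime_ideal Q -> Q `<=` P -> Q = P.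

Definition ideal_gen (A : set R) : set R := smallest is_ideal A.

Definition is_principal I : Prop := exists a : R, I = ideal_gen [set a].

Definition noetherian : Prop :=
  forall I, is_ideal I -> exists s : seq R, I = ideal_gen [set` s].

Definition positive_height I : Prop :=
  forall P, is_minimal_prime P -> ~ (I `<=` P).

(* The set written R° in the literature. *)
Definition Rcirc : set R := [set x | forall P, is_minimal_prime P -> ~ P x].

Definition ideal_mul I J : set R :=
  ideal_gen [set z | exists x y, [/\ I x, J y & z = x * y]].

Definition ideal_exp I (n : nat) : set R := iter n (ideal_mul I) setT.

Definition ideal_colon I J : set R := [set x | forall y, J y -> I (x * y)].

Definition integral_closure I : set R :=
  [set x | exists2 n : nat, (0 < n)%N & exists2 a : nat -> R,
     (forall i, (1 <= i <= n)%N -> ideal_exp I i (a i)) &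
     x ^+ n + \sum_(1 <= i < n.+1) a i * x ^+ (n - i) = 0].

(* Meaningful for [0 < t] only: the ceiling is then a nonnegative integer, and
   the absolute value merely converts it to a natural number. *)
Definition HY_closure (K : realType) (aa : set R) (t : K) I : set R :=
  [set x | exists2 c : R, Rcirc c & exists N : nat, forall n : nat, (N <= n)%N ->
     forall y, ideal_exp aa `|Num.ceil (t * n%:R)|%N y ->
       ideal_exp I n (c * x ^+ n * y)].

(* The rational power of exponent r/s. The set depends only on the quotient r/s,
   but this is a fact about integral closures and not part of the definition. *)
Definition rational_power (aa : set R) (r s : nat) : set R :=
  [set x | integral_closure (ideal_exp aa r) (x ^+ s)].

End Ideals.

Arguments noetherian R : clear implicits.
Arguments Rcirc R : clear implicits.

(* Main.v *)
From HB Require Import structures.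
Require Import Defs.
From mathcomp Require Import all_boot all_order all_algebra.
From mathcomp Require Import boolp classical_sets reals.
From mathcomp Require Import zify ring.

(** The engine is the multiplier description of integral closure: in a
    noetherian ring, for an ideal I of positive height, x is integral over I if
    and only if some c in R° satisfies c x^n in I^n for all n
    ([integral_multiplier], [multiplier_integral]). This is the definition of
    the Hara-Yoshida closure with the factor from aa left out, and the
    theorem follows from it by manipulating exponents.

    If x satisfies an integral equation of degree k, then x^(n+k) lies in I^n,
    so any c = a^k with a in I and in R° is a multiplier; such an a exists by
    prime avoidance among the finitely many minimal primes
    ([finite_minimal_primes], [positive_height_Rcirc]). Conversely, let
    c x^n in I^n for large n. The elements (c x^n) T^n of the Rees algebra
    R[IT], which is noetherian by Hilbert's basis theorem
    ([adjoin_seq_noetherian]), satisfy a linear relation, whose homogeneous component reads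
    c (x^d - sum_i b_i x^(d-i)) = 0 with b_i in I^i ([power_dependence]). Since
    c avoids every minimal prime, the second factor is nilpotent, and one of
    its powers gives an integral equation for x.

    For an integer parameter m (part (c), [HY_closure_nat]) the inclusion of
    the closure in the colon is immediate, as y^n lies in aa^(mn) for y in
    aa^m. For the other one, the ideal x aa^m is contained in the integral
    closure of I; being finitely generated, it has one multiplier c that
    serves all its powers simultaneously ([uniform_multiplier]), and its n-th power contains
    x^n aa^(mn).

    In part (a), the exponent ceil(t n) exceeds ceil((t - 1) n) by exactly n,
    which gives the inclusion, and also the equality when aa = (a), as then
    aa^(n+k) = a^n aa^k; for integral t both sides are colon ideals by (c). In
    part (b), a multiplier for y^s over aa^r, where y is in the rational
    power, turns the condition on x at the exponents divisible by s into a
    multiplier for x y; the second inclusion is (c) for the integer ceil(t),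
    because aa^ceil(t) lies in the rational power. *)

Set Implicit Arguments.
Unset Strict Implicit.
Unset Printing Implicit Defensive.

Import Order.TTheory GRing.Theory Num.Theory.
Local Open Scope classical_set_scope.
Local Open Scope ring_scope.

(** * Submodules and noetherian subrings of an ambient ring *)

Section Subrings.
Variable S : comPzRingType.
Implicit Types (A B M : set S) (z : S) (f : nat -> S).

Definition is_subring B : Prop :=
  [/\ B 1, B (-1), forall x y, B x -> B y -> B (x + y)
    & forall x y, B x -> B y -> B (x * y)].

Definition is_submodule B M : Prop :=
  [/\ M 0, forall x y, M x -> M y -> M (x + y)
    & forall b x, B b -> M x -> M (b * x)].

Definition span B A : set S := smallest (is_submodule B) A.

(** Noetherianity in terms of sequences: this is the form that is consumed, both
    in the basis theorem, for leading coefficients, and in the Rees algebra, for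
    the elements (c x^n) T^n. *)
Definition seq_noetherian B : Prop :=
  forall f, (forall i, B (f i)) -> exists n, span B (f @` `I_n) (f n).

(** The B-submodule of polynomial expressions in z of degree less than e. Such
    expressions need not be unique, so degree and leading coefficient are
    properties of a presentation and not of the element. *)
Definition poly_lt B z (e : nat) : set S := span B (GRing.exp z @` `I_e).

Definition adjoin B z : set S := \bigcup_e poly_lt B z e.

Lemma span_submodule B A : is_submodule B (span B A).
Proof.
split.
- by move=> M [[]].
- move=> x y Ax Ay M HM; have [[_ MD _] _] := HM.
  by apply: MD; [exact: Ax|exact: Ay].
- by move=> b x Bb Ax M HM; have [[_ _ MM] _] := HM; apply: MM => //; exact: Ax.
Qed.

Lemma span_gen B A : A `<=` span B A.
Proof. exact: sub_gen_smallest. Qed.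

Lemma span_sub B A M : is_submodule B M -> A `<=` M -> span B A `<=` M.
Proof. exact: smallest_sub. Qed.

Lemma span_ind B A (P : S -> Prop) :
  is_submodule B P -> (forall x, A x -> P x) -> forall x, span B A x -> P x.
Proof. exact: span_sub. Qed.

Lemma span_trans B A A' : A `<=` span B A' -> span B A `<=` span B A'.
Proof. exact: span_sub (span_submodule _ _). Qed.

Lemma span_mono B A A' : A `<=` A' -> span B A `<=` span B A'.
Proof. by move=> AA'; apply: span_trans => x /AA'; apply: span_gen. Qed.

Lemma image_below_mono f m n : (m <= n)%N -> f @` `I_m `<=` f @` `I_n.
Proof. by move=> mn _ [i /= im <-]; exists i => //=; apply: leq_trans mn. Qed.

Lemma submodule_sum {B M I} {r : seq I} {P : pred I} {F : I -> S} :
  is_submodule B M -> (forall i, P i -> M (F i)) -> M (\sum_(i <- r | P i) F i).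
Proof. by move=> [M0 MD _] MF; elim/big_ind: _. Qed.

Lemma submoduleN B M x : B (-1) -> is_submodule B M -> M x -> M (- x).
Proof. by move=> BN [_ _ MM] Mx; rewrite -mulN1r; apply: MM. Qed.

Lemma subring_submodule B : is_subring B -> is_submodule B B.
Proof. by case=> B1 BN BD BM; split=> //; rewrite -(subrr 1); apply: BD. Qed.

Lemma span_image_sum B f n y : is_subring B -> span B (f @` `I_n) y ->
  exists2 b : nat -> S, forall i, B (b i) & y = \sum_(i < n) b i * f i.
Proof.
move=> sB; have [B0 BD BM] := subring_submodule sB.
move: y; apply: span_ind; last first.
  move=> _ [i /= ltin <-]; exists (fun j => (j == i)%:R) => [j|].
    by case: (j == i) => //; case: sB.
  rewrite (bigD1 (Ordinal ltin)) //= eqxx mul1r big1 ?addr0 // => j.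
  by rewrite -val_eqE /= => /negPf->; rewrite mul0r.
split=> [|x y [b Bb ->] [b' Bb' ->]|a x Ba [b Bb ->]].
- by exists (fun=> 0) => //; rewrite big1 // => i _; rewrite mul0r.
- exists (fun i => b i + b' i) => [i|]; first exact: BD.
  by rewrite -big_split; apply: eq_bigr => i _; rewrite mulrDl.
- exists (fun i => a * b i) => [i|]; first exact: BM.
  by rewrite mulr_sumr; apply: eq_bigr => i _; rewrite mulrA.
Qed.

Section Adjoin.
Variables (B : set S) (z : S).
Hypothesis sB : is_subring B.

Lemma poly_lt_mono d e : (d <= e)%N -> poly_lt B z d `<=` poly_lt B z e.
Proof. by move=> de; apply: span_mono; apply: image_below_mono. Qed.

Lemma poly_lt0 y : poly_lt B z 0 y -> y = 0.
Proof.
move: y; apply: span_ind => [|y [i]] //.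
split=> //= [x y -> ->|b x _ ->]; first exact: addr0.
exact: mulr0.
Qed.

Lemma poly_ltX k e : (k < e)%N -> poly_lt B z e (z ^+ k).
Proof. by move=> ke; apply: span_gen; exists k. Qed.

Lemma poly_lt_lead e y : poly_lt B z e.+1 y ->
  exists c y', [/\ B c, poly_lt B z e y' & y = y' + c * z ^+ e].
Proof.
have [B0 BD BM] := subring_submodule sB.
have [L0 LD LM] := span_submodule B (GRing.exp z @` `I_e).
move: y; apply: span_ind; last first.
  move=> _ [i /= + <-]; rewrite ltnS leq_eqVlt => /predU1P[->|ie].
    by exists 1, 0; split=> //; [case: sB|rewrite mul1r add0r].
  by exists 0, (z ^+ i); split=> //; [apply: poly_ltX|rewrite mul0r addr0].
split.
- by exists 0, 0; split=> //; rewrite mul0r addr0.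
- move=> x y [c [x' [Bc Lx ->]]] [d [y' [Bd Ly ->]]].
  exists (c + d), (x' + y'); split; [exact: BD|exact: LD|].
  by rewrite mulrDl addrACA.
- move=> b x Bb [c [x' [Bc Lx ->]]].
  exists (b * c), (b * x'); split; [exact: BM|exact: LM|].
  by rewrite mulrDr mulrA.
Qed.

Lemma poly_ltMX e k y : poly_lt B z e y -> poly_lt B z (k + e) (z ^+ k * y).
Proof.
have [L0 LD LM] := span_submodule B (GRing.exp z @` `I_(k + e)).
move: y; apply: span_ind => [|_ [i /= ie <-]]; last first.
  by rewrite -exprD; apply: poly_ltX; rewrite ltn_add2l.
split=> /= [|x y Lx Ly|b x Bb Lx]; first by rewrite mulr0.
  by rewrite mulrDr; apply: LD.
by rewrite mulrCA; apply: LM.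
Qed.

Lemma poly_ltM d e x y :
  poly_lt B z d x -> poly_lt B z e y -> poly_lt B z (d + e) (x * y).
Proof.
move=> + Ly; have [L0 LD LM] := span_submodule B (GRing.exp z @` `I_(d + e)).
move: x; apply: span_ind => [|_ [i /= id <-]]; last first.
  by apply: (@poly_lt_mono (i + e)); [lia|apply: poly_ltMX].
split=> /= [|x x' Lx Lx'|b x Bb Lx]; first by rewrite mul0r.
  by rewrite mulrDl; apply: LD.
by rewrite -mulrA; apply: LM.
Qed.

Lemma adjoin_base : B `<=` adjoin B z.
Proof.
move=> b Bb; exists 1%N => //; rewrite -[b]mulr1 -(expr0 z).
have [_ _ LM] := span_submodule B (GRing.exp z @` `I_1).
by apply: LM => //; apply: poly_ltX.
Qed.

Lemma adjoin_gen : adjoin B z z.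
Proof. by exists 2%N => //; rewrite -{2}[z]expr1; apply: poly_ltX. Qed.

Lemma adjoin_subring : is_subring (adjoin B z).
Proof.
have [B1 BN BD BM] := sB; split; [exact: adjoin_base|exact: adjoin_base| |].
  move=> x y [d _ Lx] [e _ Ly]; exists (d + e)%N => //.
  have [_ LD _] := span_submodule B (GRing.exp z @` `I_(d + e)).
  apply: LD; first by apply: poly_lt_mono Lx; apply: leq_addr.
  by apply: poly_lt_mono Ly; apply: leq_addl.
by move=> x y [d _ Lx] [e _ Ly]; exists (d + e)%N => //; apply: poly_ltM.
Qed.

Lemma adjoin_sub D : is_subring D -> B `<=` D -> D z -> adjoin B z `<=` D.
Proof.
move=> sD BD Dz y [e _]; have [D0 DD DM] := subring_submodule sD.
move: y; apply: span_ind => [|_ [i _ <-]].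
  by split=> // b x Bb; apply: DM; apply: BD.
elim: i => [|i IHi]; first by case: sD.
by rewrite exprS; apply: DM.
Qed.

(** Hilbert's basis theorem. Were the sequence f a counterexample, one could
    keep choosing, in the submodule J that f generates over B[z], an element of
    least degree in z outside the span of those chosen before. By hypothesis
    on B, some leading coefficient is a combination of the earlier ones, and
    subtracting the corresponding multiples of the earlier elements, which
    have no larger degree, contradicts minimality. *)
Theorem adjoin_seq_noetherian : seq_noetherian B -> seq_noetherian (adjoin B z).
Proof.
move=> nB f Cf; apply: contrapT => nof.
have {}nof n : ~ span (adjoin B z) (f @` `I_n) (f n).
  by move=> fn; apply: nof; exists n.
set C := adjoin B z in Cf nof *.
have sC : is_subring C := adjoin_subring.
pose J := \bigcup_n span C (f @` `I_n).
have smJ : is_submodule C J.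
  split=> [|x y [m _ Jx] [n _ Jy]|b x Cb [m _ Jx]].
  - by exists 0%N => //; case: (span_submodule C (f @` `I_0)).
  - exists (m + n)%N => //.
    have [_ LD _] := span_submodule C (f @` `I_(m + n)).
    apply: LD.
      by apply: span_mono Jx; apply: image_below_mono; apply: leq_addr.
    by apply: span_mono Jy; apply: image_below_mono; apply: leq_addl.
  - by exists m => //; have [_ _] := span_submodule C (f @` `I_m); apply.
pose fresh A y := J y /\ ~ span C A y.
pose small A := exists m, A `<=` span C (f @` `I_m).
have /choice[g gP] : forall A, exists p : nat * S, small A ->
    [/\ fresh A p.2, poly_lt B z p.1 p.2 &
      forall e y, fresh A y -> poly_lt B z e y -> (p.1 <= e)%N].
  move=> A.
  have [[m Am]|?] := pselect (small A); last by exists (0%N, 0).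
  have fA : fresh A (f m).
    split; first by exists m.+1 => //; apply: span_gen; exists m => /=.
    by move/(span_trans Am); apply: nof.
  pose P e := `[< exists2 y, fresh A y & poly_lt B z e y >].
  have exP : exists e, P e.
    by have [e _ Le] := Cf m; exists e; apply/asboolP; exists (f m).
  case: (ex_minnP exP) => e /asboolP[y Ay Ly] emin.
  exists (e, y) => _; split=> // d x Ax Lx.
  by apply: emin; apply/asboolP; exists x.
pose A_ n := iter n (fun A => A `|` [set (g A).2]) set0.
have A_S n : A_ n.+1 = A_ n `|` [set (g (A_ n)).2] by [].
have A_mono m n : (m <= n)%N -> A_ m `<=` A_ n.
  elim: n => [|n IHn]; first by rewrite leqn0 => /eqP->.
  by rewrite leq_eqVlt ltnS => /predU1P[->//|/IHn mn x /mn]; rewrite A_S; left.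
have sA n : small (A_ n).
  elim: n => [|n [m IHm]]; first by exists 0%N.
  have [[[k _ Jk] _] _ _] := gP _ (ex_intro _ m IHm : small (A_ n)).
  exists (m + k)%N => x; rewrite A_S => -[/IHm|->].
    by apply: span_mono; apply: image_below_mono; apply: leq_addr.
  by apply: span_mono Jk; apply: image_below_mono; apply: leq_addl.
pose e_ n := (g (A_ n)).1; pose y_ n := (g (A_ n)).2.
have yJ n : J (y_ n) by have [[]] := gP _ (sA n).
have ynot n : ~ span C (A_ n) (y_ n) by have [[]] := gP _ (sA n).
have ydeg n : poly_lt B z (e_ n) (y_ n) by have [] := gP _ (sA n).
have emin n e y : J y -> ~ span C (A_ n) y -> poly_lt B z e y -> (e_ n <= e)%N.
  by have [_ _ H] := gP _ (sA n) => Jy Ay; apply: H.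
have yin i n : (i < n)%N -> span C (A_ n) (y_ i).
  by move=> lin; apply: span_gen; apply: (A_mono i.+1 n lin); rewrite A_S; right.
have e_gt0 n : (0 < e_ n)%N.
  rewrite lt0n; apply/eqP => e0; have := ydeg n; rewrite e0 => /poly_lt0 y0.
  by apply: (ynot n); rewrite y0; case: (span_submodule C (A_ n)).
have e_mono i n : (i <= n)%N -> (e_ i <= e_ n)%N.
  move=> lin; apply: emin (ydeg n) => //.
  by move/(span_mono (A_mono _ _ lin)); apply: ynot.
have /choice[h hP] : forall n, exists p : S * S,
    [/\ B p.1, poly_lt B z (e_ n).-1 p.2 &
        y_ n = p.2 + p.1 * z ^+ (e_ n).-1].
  move=> n; have := ydeg n; rewrite -{1}(prednK (e_gt0 n)).
  by move/poly_lt_lead => -[c [y' ?]]; exists (c, y').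
pose c n := (h n).1; pose y' n := (h n).2.
have ycy' n : [/\ B (c n), poly_lt B z (e_ n).-1 (y' n) &
    y_ n = y' n + c n * z ^+ (e_ n).-1] := hP n.
have Bc n : B (c n) by have [] := ycy' n.
have [n /(span_image_sum sB)[b Bb cn]] := nB c Bc.
pose comb := \sum_(i < n) b i * (z ^+ (e_ n - e_ i) * y_ i).
have [spL0 spD spM] := span_submodule C (A_ n).
have CX k : C (z ^+ k) by exists k.+1 => //; apply: poly_ltX.
have comb_span : span C (A_ n) comb.
  rewrite /comb; apply: (submodule_sum (span_submodule C (A_ n))) => i _.
  by apply: (spM); [apply: adjoin_base|apply: (spM) => //; apply: yin].
have CN : C (-1) by case: sC.
have := emin n (e_ n).-1 (y_ n - comb); rewrite -ltnS prednK // ltnn => H.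
suff: false by []; apply: H.
- have [_ JD JM] := smJ; apply: JD => //; apply: (submoduleN CN smJ).
  rewrite /comb; apply: (submodule_sum smJ) => i _.
  by apply: (JM); [apply: adjoin_base|apply: (JM)].
- by move=> spw; apply: (ynot n); rewrite -(subrK comb (y_ n)); apply: spD.
- have -> : y_ n - comb =
      y' n - \sum_(i < n) b i * (z ^+ (e_ n - e_ i) * y' i).
    have [_ _ ->] := ycy' n; rewrite cn mulr_suml /comb.
    have -> : \sum_(i < n) b i * (z ^+ (e_ n - e_ i) * y_ i) =
        \sum_(i < n) b i * (z ^+ (e_ n - e_ i) * y' i) +
        \sum_(i < n) b i * c i * z ^+ (e_ n).-1.
      rewrite -big_split; apply: eq_bigr => i _ /=.
      have [_ _ ->] := ycy' i; rewrite !mulrDr; congr (_ + _).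
      rewrite [z ^+ _ * (_ * _)]mulrCA -exprD mulrA; congr (_ * z ^+ _).
      by have := e_mono i n (ltnW (ltn_ord i)); have := e_gt0 i; lia.
    by rewrite opprD addrACA subrr addr0.
  have [_ LD LM] := span_submodule B (GRing.exp z @` `I_(e_ n).-1).
  have BN : B (-1) by case: sB.
  have [_ Ly' _] := ycy' n; apply: LD => //.
  apply: (submoduleN BN (span_submodule _ _)).
  apply: (submodule_sum (span_submodule _ _)) => i _; apply: LM => //.
  have [_ /(poly_ltMX (k:=(e_ n - e_ i)%N)) + _] := ycy' i; apply: poly_lt_mono.
  by have := e_mono i n (ltnW (ltn_ord i)); have := e_gt0 i; lia.
Qed.

End Adjoin.
End Subrings.

(** * Ideals and their powers *)

Section Ideals.
Variable R : comPzRingType.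
Implicit Types (I J L A : set R) (x y z : R).

Lemma is_idealE I : is_ideal I <-> is_submodule setT I.
Proof. by split=> -[I0 ID IM]; split=> // a x; [move=> _|]; exact: IM. Qed.

Lemma ideal0 I : is_ideal I -> I 0.
Proof. by case. Qed.

Lemma idealD I x y : is_ideal I -> I x -> I y -> I (x + y).
Proof. by case=> _ ID _; exact: ID. Qed.

Lemma idealMl I a x : is_ideal I -> I x -> I (a * x).
Proof. by case=> _ _; exact. Qed.

Lemma idealMr I a x : is_ideal I -> I x -> I (x * a).
Proof. by rewrite mulrC; exact: idealMl. Qed.

Lemma idealN I x : is_ideal I -> I x -> I (- x).
Proof. by rewrite -mulN1r; exact: idealMl. Qed.

Lemma ideal_sum {I} {T} {r : seq T} {P : pred T} {F : T -> R} :
  is_ideal I -> (forall i, P i -> I (F i)) -> I (\sum_(i <- r | P i) F i).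
Proof. by move/is_idealE; exact: submodule_sum. Qed.

Lemma ideal_preim I a : is_ideal I -> is_ideal [set x | I (a * x)].
Proof.
move=> idI; split=> [|x y Ix Iy|b x Ix] /=.
- by rewrite mulr0; apply: ideal0.
- by rewrite mulrDr; apply: idealD.
- by rewrite mulrCA; apply: idealMl.
Qed.

Lemma ideal_preimr I a : is_ideal I -> is_ideal [set x | I (x * a)].
Proof.
move=> idI; have [I0 ID IM] := ideal_preim a idI.
by split=> [|x y|b x] /=; rewrite ![_ * a]mulrC; [exact: I0|exact: ID|exact: IM].
Qed.

Lemma ideal_gen_ideal A : is_ideal (ideal_gen A).
Proof.
split.
- by move=> M [[]].
- move=> x y Ax Ay M HM; have [[_ MD _] _] := HM.
  by apply: MD; [exact: Ax|exact: Ay].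
- by move=> b x Ax M HM; have [[_ _ MM] _] := HM; apply: MM; exact: Ax.
Qed.

Lemma ideal_gen_sub A : A `<=` ideal_gen A.
Proof. exact: sub_gen_smallest. Qed.

Lemma ideal_gen_ind A (P : R -> Prop) :
  is_ideal P -> (forall x, A x -> P x) -> forall x, ideal_gen A x -> P x.
Proof. exact: smallest_sub. Qed.

Lemma ideal_gen1 a x : ideal_gen [set a] x -> exists b, x = b * a.
Proof.
move: x; apply: ideal_gen_ind => [|_ ->]; last by exists 1; rewrite mul1r.
split=> [|x y [b ->] [c ->]|b x [c ->]].
- by exists 0; rewrite mul0r.
- by exists (b + c); rewrite mulrDl.
- by exists (b * c); rewrite mulrA.
Qed.

Lemma ideal_mul_ind I J (P : R -> Prop) :
  is_ideal P -> (forall x y, I x -> J y -> P (x * y)) ->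
  forall z, ideal_mul I J z -> P z.
Proof.
by move=> idP PM; apply: ideal_gen_ind => // _ [x [y [Ix Jy ->]]]; apply: PM.
Qed.

Lemma mem_ideal_mul I J x y : I x -> J y -> ideal_mul I J (x * y).
Proof. by move=> Ix Jy; apply: ideal_gen_sub; exists x, y. Qed.

Lemma ideal_mul_ideal I J : is_ideal (ideal_mul I J).
Proof. exact: ideal_gen_ideal. Qed.

Lemma ideal_exp_ideal I n : is_ideal (ideal_exp I n).
Proof. by case: n => [//|n]; exact: ideal_gen_ideal. Qed.
Local Hint Resolve ideal_exp_ideal ideal_mul_ideal ideal_gen_ideal : core.

Lemma ideal_exp_mono I m n : (m <= n)%N -> ideal_exp I n `<=` ideal_exp I m.
Proof.
move/subnKC <-; move: (n - m)%N => k; elim: m => [|m IHm] //.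
rewrite addSn; apply: ideal_mul_ind => // x y Ix /IHm.
exact: mem_ideal_mul.
Qed.

Lemma ideal_expD I m n x y :
  ideal_exp I m x -> ideal_exp I n y -> ideal_exp I (m + n) (x * y).
Proof.
move=> + In; elim: m x => [|m IHm] x; first by move=> _; apply: idealMl.
move: x; apply: ideal_mul_ind => [|a b Ia Ib]; first exact: ideal_preimr.
by rewrite -mulrA addSn; apply: mem_ideal_mul => //; apply: IHm.
Qed.

Lemma ideal_exp1 I x : I x -> ideal_exp I 1 x.
Proof. by move=> Ix; rewrite -[x]mulr1; apply: mem_ideal_mul. Qed.

Lemma ideal_expX I m n x : ideal_exp I m x -> ideal_exp I (m * n) (x ^+ n).
Proof.
move=> Ix; elim: n => [|n IHn]; first by rewrite muln0.
by rewrite exprS mulnS; apply: ideal_expD.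
Qed.

Lemma mem_ideal_exp I n x : I x -> ideal_exp I n (x ^+ n).
Proof. by move=> /ideal_exp1/(@ideal_expX _ _ n); rewrite mul1n. Qed.

Lemma ideal_exp_split I m n :
  ideal_exp I (m + n) `<=` ideal_mul (ideal_exp I m) (ideal_exp I n).
Proof.
elim: m => [|m IHm] x.
  by move=> Ix; rewrite -[x]mul1r; apply: mem_ideal_mul.
rewrite addSn; move: x; apply: ideal_mul_ind => [|x y Ix /IHm].
  exact: ideal_gen_ideal.
move: y; apply: ideal_mul_ind => [|a b Ia Ib].
  exact/ideal_preim/ideal_gen_ideal.
by rewrite mulrA; apply: mem_ideal_mul => //; apply: mem_ideal_mul.
Qed.

Lemma chain_union_ideal (J_ : nat -> set R) :
  (forall n, is_ideal (J_ n)) -> (forall m n, (m <= n)%N -> J_ m `<=` J_ n) ->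
  is_ideal (\bigcup_n J_ n).
Proof.
move=> idJ Jmono; split=> [|x y [m _ Jx] [n _ Jy]|a x [n _ Jx]].
- by exists 0%N => //; apply: ideal0.
- exists (m + n)%N => //; apply: idealD => //.
    by apply: Jmono Jx; apply: leq_addr.
  by apply: Jmono Jy; apply: leq_addl.
- by exists n => //; apply: idealMl.
Qed.

Lemma setT_subring : is_subring [set: R].
Proof. by []. Qed.

(** The ideals generated by the initial segments of the sequence form a chain;
    its union is finitely generated, hence equal to a member of the chain. *)
Lemma noetherian_seq : noetherian R -> seq_noetherian [set: R].
Proof.
move=> hR f _; pose J_ n := span setT (f @` `I_n).
have idJ n : is_ideal (J_ n) by apply/is_idealE; apply: span_submodule.
have Jmono m n : (m <= n)%N -> J_ m `<=` J_ n.
  by move=> mn; apply: span_mono; apply: image_below_mono.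
have [s sE] := hR _ (chain_union_ideal idJ Jmono).
have [n sn] : exists n, forall x, x \in s -> J_ n x.
  have: forall x, x \in s -> (\bigcup_n J_ n) x.
    by move=> x xs; rewrite sE; apply: ideal_gen_sub.
  elim: {sE} s => [|a s IHs] Hs; first by exists 0%N.
  have [n Hn] := IHs (fun x xs => Hs x (mem_behead (s := a :: s) xs)).
  have [m _ Hm] := Hs a (mem_head _ _); exists (m + n)%N => x.
  rewrite inE => /predU1P[->|xs]; first by apply: Jmono Hm; apply: leq_addr.
  by apply: Jmono (Hn x xs); apply: leq_addl.
exists n; have: (\bigcup_n J_ n) (f n).
  by exists n.+1 => //; apply: span_gen; exists n => /=.
rewrite sE; move: (f n); apply: ideal_gen_ind => [|x]; [exact: idJ|exact: sn].
Qed.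

(** Noetherian induction: an infinite strictly increasing chain of
    ideals would yield a sequence none of whose terms lies in the ideal
    generated by the previous ones. *)
Lemma noetherian_ind (P : set R -> Prop) : noetherian R ->
  (forall J, is_ideal J ->
     (forall L, is_ideal L -> J `<=` L -> ~ L `<=` J -> P L) -> P J) ->
  forall J, is_ideal J -> P J.
Proof.
move=> /noetherian_seq nR Pind J0 idJ0; apply: contrapT => nPJ0.
pose bad J := is_ideal J /\ ~ P J.
have /choice[g gP] : forall J, exists Lx : set R * R, bad J ->
    [/\ bad Lx.1, J `<=` Lx.1, Lx.1 Lx.2 & ~ J Lx.2].
  move=> J; have [[idJ nPJ]|?] := pselect (bad J); last by exists (J, 0).
  apply: contrapT => none; apply/nPJ/Pind => // L idL JL nLJ.
  apply: contrapT => nPL; apply: nLJ => x Lx; apply: contrapT => nJx.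
  by apply: none; exists (L, x).
pose J_ n := iter n (fun J => (g J).1) J0.
have badJ n : bad (J_ n) by elim: n => //= n /gP[].
have Jmono m n : (m <= n)%N -> J_ m `<=` J_ n.
  elim: n => [|n IHn]; first by rewrite leqn0 => /eqP->.
  rewrite leq_eqVlt ltnS => /predU1P[->//|/IHn mn]; apply: (subset_trans mn).
  by have [] := gP _ (badJ n).
have [//|n] := nR (fun n => (g (J_ n)).2).
have [_ _ _ nJ] := gP _ (badJ n); move=> spn; apply: nJ.
have [idJn _] := badJ n; move: spn; apply: span_ind => [|_ [i /= lin <-]].
  exact/is_idealE.
by apply: (Jmono i.+1) => //; have [] := gP _ (badJ i).
Qed.

End Ideals.
#[global] Hint Resolve ideal_exp_ideal ideal_mul_ideal ideal_gen_ideal : core.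

(** * The Rees algebra *)

Section Rees.
Variable R : comNzRingType.
Implicit Types (I : set R) (s : seq R).

(** The Rees algebra R[IT] of the ideal I generated by s, built by adjoining one
    degree-one generator at a time, as the basis theorem requires. That its
    component of degree n is I^n T^n is the content of [rees_homog] and
    [rees_coef]. *)
Definition rees s : set {poly R} :=
  foldr (fun a B => adjoin B (a *: 'X)) (range polyC) s.

Lemma constants_subring : is_subring (range (@polyC R)).
Proof.
split.
- by exists 1.
- by exists (-1) => //; rewrite polyCN.
- by move=> _ _ [a _ <-] [b _ <-]; exists (a + b) => //; rewrite polyCD.
- by move=> _ _ [a _ <-] [b _ <-]; exists (a * b) => //; rewrite polyCM.
Qed.

Lemma rees_subring s : is_subring (rees s).
Proof.
elim: s => [|a s IHs]; first exact: constants_subring.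
exact: adjoin_subring.
Qed.

Lemma rees_noetherian s : noetherian R -> seq_noetherian (rees s).
Proof.
move=> hR; elim: s => [|a s IHs]; last first.
  by apply: adjoin_seq_noetherian IHs; exact: rees_subring.
move=> f /(_ _)/cid2-/all_sig2[r _ rf].
have [//|n] := noetherian_seq hR (f := r).
move=> /(span_image_sum (setT_subring R))[b _ rn]; exists n.
rewrite -rf rn rmorph_sum /=.
have sm := span_submodule (rees [::]) (f @` `I_n).
apply: (submodule_sum sm) => i _; rewrite polyCM rf.
have [_ _ smM] := sm; apply: smM; first by exists (b i).
by apply: span_gen; exists i => /=.
Qed.

Lemma rees_const s a : rees s a%:P.
Proof. by elim: s => [|b s IHs] /=; [exists a|apply: adjoin_base]. Qed.

Lemma rees_gen s a : a \in s -> rees s (a *: 'X).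
Proof.
elim: s => //= b s IHs; rewrite inE => /predU1P[->|/IHs]; first exact: adjoin_gen.
exact: adjoin_base.
Qed.

Lemma rees_homog s n y :
  ideal_exp (ideal_gen [set` s]) n y -> rees s (y *: 'X^n).
Proof.
have [R0 RD RM] := subring_submodule (rees_subring s).
have idl m p : is_ideal [set a : R | rees s (a *: 'X^m * p)].
  split=> [|u v Ru Rv|a u Ru] /=.
  - by rewrite scale0r mul0r.
  - by rewrite scalerDl mulrDl; apply: RD.
  - rewrite -scalerA -scalerAl -mul_polyC; apply: RM => //; exact: rees_const.
elim: n y => [y _|n IHn y].
  by rewrite expr0 alg_polyC; apply: rees_const.
have sub y' : rees s (y' *: 'X^(n.+1) * 1) = rees s (y' *: 'X^(n.+1)).
  by rewrite mulr1.
rewrite -sub; move: y; apply: ideal_mul_ind => [|x y Ix /IHn Ry]; first exact: idl.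
have -> : (x * y) *: 'X^(n.+1) * 1 = x *: 'X^1 * (y *: 'X^n) :> {poly R}.
  by rewrite mulr1 expr1 exprS -scalerAl -scalerAr scalerA.
move: x Ix; apply: ideal_gen_ind; first exact: idl.
by move=> x xs; rewrite expr1; apply: RM => //; apply: rees_gen.
Qed.

Lemma rees_coef s p i : rees s p -> ideal_exp (ideal_gen [set` s]) i p`_i.
Proof.
set I := ideal_gen _.
pose D := [set p : {poly R} | forall i, ideal_exp I i p`_i].
have D1 : D 1.
  by move=> [|j]; rewrite // coef1 /=; apply: ideal0.
have sD : is_subring D.
  split=> //.
  - by move=> j; rewrite coefN; apply: idealN => //; apply: D1.
  - by move=> q r Dq Dr j; rewrite coefD; apply: idealD.
  - move=> q r Dq Dr j; rewrite coefM; apply: ideal_sum => // k _.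
    have := ideal_expD (Dq k) (Dr (j - k)%N).
    by rewrite subnKC // -ltnS.
have sub s' : (forall a, a \in s' -> I a) -> rees s' `<=` D.
  elim: s' => [_ _ [a _ <-] j|a s' IHs s'I].
    by rewrite coefC; case: j => [|j]; [|apply: ideal0].
  apply: adjoin_sub => //.
    by apply: IHs => b bs'; apply: s'I; rewrite inE bs' orbT.
  case=> [|[|j]]; rewrite coefZ coefX ?mulr0 ?mulr1; try exact: ideal0.
  by apply: ideal_exp1; apply: s'I; rewrite mem_head.
move=> rsp; apply: (sub s) rsp i => a sa.
exact: (@ideal_gen_sub _ [set` s]).
Qed.

End Rees.

(** Apply noetherianity of the Rees algebra to the homogeneous elements
    f_n T^(N+n), and compare the coefficients of T^(N+n). *)
Lemma nz_power_dependence (R : comNzRingType) (I : set R) N (f : nat -> R) :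
  noetherian R -> is_ideal I -> (forall n, ideal_exp I (N + n) (f n)) ->
  exists n, exists2 g : nat -> R,
    forall i, (i < n)%N -> ideal_exp I (n - i) (g i) &
    f n = \sum_(i < n) g i * f i.
Proof.
move=> hR idI If; have [s sE] := hR I idI; rewrite sE in If *.
have [n|n] := @rees_noetherian R s hR (fun n => f n *: 'X^(N + n)).
  exact: rees_homog.
move/(span_image_sum (rees_subring s)) => [b sb fn].
exists n, (fun i => (b i)`_(n - i)) => [i _|]; first exact: rees_coef.
have /(congr1 (fun p : {poly R} => p`_(N + n))) := fn.
rewrite coefZ coefXn eqxx mulr1 => ->; rewrite coef_sum.
apply: eq_bigr => i _; rewrite -scalerAr coefZ coefMXn mulrC.
by rewrite ltn_add2l ltnNge ltnW //= subnDl.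
Qed.

Section NoetherianRing.
Variable R : comPzRingType.
Hypothesis hR : noetherian R.
Implicit Types (I J P Q : set R) (c x y : R).

(** The zero ring, over which there are no polynomials, satisfies
    this trivially. *)
Lemma power_dependence I N (f : nat -> R) :
  is_ideal I -> (forall n, ideal_exp I (N + n) (f n)) ->
  exists n, exists2 g : nat -> R,
    forall i, (i < n)%N -> ideal_exp I (n - i) (g i) &
    f n = \sum_(i < n) g i * f i.
Proof.
have [e10|ne10] := eqVneq (1 : R) 0.
  exists 0%N, (fun=> 0) => //; rewrite big_ord0.
  by rewrite -[f 0%N]mulr1 e10 mulr0.
pose R' : comNzRingType :=
  HB.pack_for comNzRingType (GRing.ComPzRing.sort R)
    (GRing.PzSemiRing_isNonZero.Build (GRing.ComPzRing.sort R) ne10).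
exact: (@nz_power_dependence R' I N f hR).
Qed.

(** * Minimal primes *)

Lemma prime_ideal P : is_prime_ideal P -> is_ideal P.
Proof. by case. Qed.

Lemma primeX P x n : is_prime_ideal P -> P (x ^+ n) -> P x.
Proof.
move=> [idP P1 PM]; elim: n => [|n IHn]; first by rewrite expr0.
by rewrite exprS => /PM[].
Qed.

Definition adjoin_ideal J (a : R) : set R :=
  [set x | exists2 j, J j & exists r, x = j + r * a].

Lemma adjoin_ideal_ideal J a : is_ideal J -> is_ideal (adjoin_ideal J a).
Proof.
move=> idJ; split=> [|x y [j Jj [r ->]] [k Jk [s ->]]|b x [j Jj [r ->]]].
- by exists 0; [exact: ideal0|exists 0; ring].
- by exists (j + k); [exact: idealD|exists (r + s); ring].
- by exists (b * j); [exact: idealMl|exists (b * r); ring].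
Qed.

Lemma adjoin_ideal_sub J a : J `<=` adjoin_ideal J a.
Proof. by move=> j Jj; exists j => //; exists 0; ring. Qed.

Lemma adjoin_ideal_gen J a : is_ideal J -> adjoin_ideal J a a.
Proof. by move=> idJ; exists 0; [exact: ideal0|exists 1; ring]. Qed.

(** An ideal that is neither prime nor the unit ideal contains a product
    (J + (a))(J + (b)) of two larger ideals; noetherian induction then
    decomposes its radical into finitely many primes. *)
Lemma finite_prime_decomposition J : is_ideal J ->
  exists Qs : seq (set R),
  [/\ forall Q, Q \in Qs -> is_prime_ideal Q,
      forall x, (forall Q, Q \in Qs -> Q x) -> exists n, J (x ^+ n) &
      forall P, is_prime_ideal P -> J `<=` P ->
        exists2 Q, Q \in Qs & Q `<=` P].
Proof.
move: J; apply: noetherian_ind => // J idJ IH.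
have [J1|J1] := pselect (J 1).
  exists [::]; split=> // [x _|P [_ P1 _] JP]; first by exists 0%N.
  by case: P1; apply: JP.
have [JM|] := pselect (forall a b, J (a * b) -> J a \/ J b).
  exists [:: J]; split=> [Q|x Jx|P _ JP].
  - by rewrite inE => /eqP->.
  - by exists 1%N; apply: Jx; rewrite inE.
  - by exists J; rewrite ?inE.
move/existsNP => [a /existsNP[b]] /not_implyP[Jab /not_orP[nJa nJb]].
have sub c : J `<=` adjoin_ideal J c := @adjoin_ideal_sub J c.
have larger c : ~ J c -> ~ adjoin_ideal J c `<=` J.
  by move=> nJc /(_ c (adjoin_ideal_gen c idJ)).
have [Qa [Qap Qan QaP]] := IH _ (adjoin_ideal_ideal a idJ) (sub a) (larger a nJa).
have [Qb [Qbp Qbn QbP]] := IH _ (adjoin_ideal_ideal b idJ) (sub b) (larger b nJb).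
exists (Qa ++ Qb); split.
- by move=> Q; rewrite mem_cat => /orP[/Qap|/Qbp].
- move=> x Qx.
  have [Q Qin|m [j Jj [r xm]]] := Qan x; first by apply: Qx; rewrite mem_cat Qin.
  have [Q Qin|n [k Jk [s xn]]] := Qbn x.
    by apply: Qx; rewrite mem_cat Qin orbT.
  exists (m + n)%N; rewrite exprD xm xn.
  have -> : (j + r * a) * (k + s * b) =
      (k + s * b) * j + (r * a * k + r * s * (a * b)) by ring.
  by apply: idealD => //; [|apply: idealD => //]; apply: idealMl.
- move=> P pP JP; have idP := prime_ideal pP.
  have above c : P c -> adjoin_ideal J c `<=` P.
    move=> Pc _ [j Jj [r ->]]; apply: idealD => //; first exact: JP.
    exact: idealMl.
  case: (pP) => _ _ PM; case: (PM _ _ (JP _ Jab)) => [/above Pa|/above Pb].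
    by have [Q Qin QP] := QaP P pP Pa; exists Q; rewrite // mem_cat Qin.
  by have [Q Qin QP] := QbP P pP Pb; exists Q; rewrite // mem_cat Qin orbT.
Qed.

Lemma finite_minimal (T : Type) (Qs : seq (set T)) (Q1 : set T) : Q1 \in Qs ->
  exists Q : set T, [/\ Q \in Qs, Q `<=` Q1 &
    forall Q' : set T, Q' \in Qs -> Q' `<=` Q -> Q' = Q].
Proof.
elim: Qs Q1 => // Q0 Qs IHQ Q1 Q1in.
have [[Q2 Q2in Q21]|none] := pselect (exists2 Q2 : set T, Q2 \in Qs & Q2 `<=` Q1).
  have [Q [Qin QQ2 Qmin]] := IHQ _ Q2in.
  have QQ1 := subset_trans QQ2 Q21.
  have [Q0Q|nQ0Q] := pselect (Q0 `<=` Q); last first.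
    exists Q; split; rewrite ?inE ?Qin ?orbT // => Q'.
    by rewrite inE => /predU1P[->//|]; exact: Qmin.
  exists Q0; split; rewrite ?mem_head //; first exact: subset_trans QQ1.
  move=> Q'; rewrite inE => /predU1P[->//|Q'in Q'Q0].
  have Q'Q := Qmin Q' Q'in (subset_trans Q'Q0 Q0Q).
  by apply/seteqP; split=> //; rewrite Q'Q.
move: Q1in; rewrite inE => /predU1P[Q10|Q1in]; last by case: none; exists Q1.
exists Q1; split; rewrite // ?Q10 ?mem_head // => Q'.
rewrite inE => /predU1P[//|Q'in Q'Q]; case: none; exists Q' => //.
by rewrite Q10.
Qed.

Lemma finite_minimal_primes : exists Ps : seq (set R),
  [/\ forall P, is_minimal_prime P -> P \in Ps,
      forall P, P \in Ps -> is_minimal_prime P &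
      forall x, (forall P, P \in Ps -> P x) -> exists n, x ^+ n = 0].
Proof.
have id0 : is_ideal [set (0 : R)].
  split=> //= [x y -> ->|a x ->]; [exact: addr0|exact: mulr0].
have [Qs [Qp Qn QP]] := finite_prime_decomposition id0.
have zero_sub P : is_prime_ideal P -> [set 0] `<=` P.
  by move=> /prime_ideal/ideal0 P0 _ ->.
have minimal_below P : is_prime_ideal P ->
    exists Q, [/\ Q \in Qs, is_minimal_prime Q & Q `<=` P].
  move=> pP; have [Q1 Q1in Q1P] := QP P pP (zero_sub P pP).
  have [Q [Qin QQ1 Qmin]] := finite_minimal Q1in.
  exists Q; split=> //; last exact: subset_trans Q1P.
  split; first exact: Qp.
  move=> Q' pQ' Q'Q; have [Q2 Q2in Q2Q'] := QP Q' pQ' (zero_sub Q' pQ').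
  apply/seteqP; split=> //.
  by rewrite -(Qmin Q2 Q2in (subset_trans Q2Q' Q'Q)).
exists [seq Q <- Qs | `[< is_minimal_prime Q >]]; split.
- move=> P [pP Pmin]; have [Q [Qin mQ QP']] := minimal_below P pP.
  rewrite mem_filter -(Pmin Q (proj1 mQ) QP') Qin andbT.
  exact/asboolP.
- by move=> P; rewrite mem_filter => /andP[/asboolP].
- move=> x Px; apply: (Qn x) => Q /Qp/minimal_below[P [Pin mP PQ]].
  by apply: PQ; apply: Px; rewrite mem_filter Pin andbT; apply/asboolP.
Qed.

Lemma minimal_primes_nilpotent x :
  (forall P, is_minimal_prime P -> P x) -> exists n, x ^+ n = 0.
Proof.
by have [Ps [_ Psm Psn]] := finite_minimal_primes => Px; apply: Psn => P /Psm/Px.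
Qed.

(** Prime avoidance. As distinct minimal primes are incomparable, some element
    of I lies in all the minimal primes already treated but not in the next
    one P; adding it repairs an element that avoids the former but lies in P. *)
Lemma minimal_prime_avoidance I (Ps : seq (set R)) :
  is_ideal I -> positive_height I ->
  (forall P, P \in Ps -> is_minimal_prime P) ->
  exists2 x, I x & forall P, P \in Ps -> ~ P x.
Proof.
move=> idI htI; elim: Ps => [|P Ps IHP] Pm; first by exists 0; first exact: ideal0.
have [Q QPs|x Ix Px] := IHP; first by apply: Pm; rewrite inE QPs orbT.
have mP := Pm P (mem_head _ _); have [pP Pmin] := mP.
have [nPx|/contrapT Px0] := pselect (~ P x).
  by exists x => // Q; rewrite inE => /predU1P[->|/Px].
have [y [Iy yPs nPy]] : exists y, [/\ I y, forall Q, Q \in Ps -> Q y & ~ P y].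
  have : forall Q, Q \in Ps -> is_prime_ideal Q /\ ~ Q `<=` P.
    move=> Q QPs; have [pQ Qmin] := Pm Q (mem_behead (s := P :: Ps) QPs).
    by split=> // /(Pmin Q pQ) QP; apply: (Px Q QPs); rewrite QP.
  elim: (Ps) => [_|Q Qs IHQ QsP].
    by have /existsNP[y /not_implyP[Iy nPy]] := htI P mP; exists y.
  have [Q' Q'in|y [Iy yQ nPy]] := IHQ.
    by apply: QsP; rewrite inE Q'in orbT.
  have [pQ /existsNP[z /not_implyP[Qz nPz]]] := QsP Q (mem_head _ _).
  exists (z * y); split; first exact: idealMl.
    move=> Q'; rewrite inE => /predU1P[->|Q'in].
      by apply: idealMr => //; apply: prime_ideal.
    apply: idealMl; last exact: yQ.
    by apply: prime_ideal; have [] := QsP Q' (mem_behead (s := Q :: Qs) Q'in).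
  by case: pP => _ _ PM /PM[].
exists (x + y) => [|Q]; first exact: idealD.
rewrite inE => /predU1P[->|QPs] Qxy.
  apply: nPy; rewrite -(addKr x y); apply: idealD => //; first exact: prime_ideal.
  by apply: idealN => //; apply: prime_ideal.
have idQ := prime_ideal (proj1 (Pm Q (mem_behead (s := P :: Ps) QPs))).
apply: (Px Q QPs); rewrite -(addrK y x); apply: idealD => //.
by apply: idealN => //; apply: yPs.
Qed.

Lemma positive_height_Rcirc I : is_ideal I -> positive_height I ->
  exists2 c, I c & Rcirc R c.
Proof.
move=> idI htI; have [Ps [mPs Psm _]] := finite_minimal_primes.
have [x Ix Px] := minimal_prime_avoidance idI htI Psm.
by exists x => // P /mPs; apply: Px.
Qed.

Lemma Rcirc1 : Rcirc R 1.
Proof. by move=> P [[]]. Qed.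

Lemma RcircM x y : Rcirc R x -> Rcirc R y -> Rcirc R (x * y).
Proof.
move=> Rx Ry P mP; have [[_ _ PM] _] := mP.
by move=> /PM[]; [apply: Rx|apply: Ry].
Qed.

Lemma RcircX x n : Rcirc R x -> Rcirc R (x ^+ n).
Proof. by move=> Rx P mP; have [pP _] := mP => /(primeX pP); apply: Rx. Qed.

Lemma Rcirc_cancel c x : Rcirc R c -> c * x = 0 -> exists n, x ^+ n = 0.
Proof.
move=> Rc cx0; apply: minimal_primes_nilpotent => P mP.
have [[idP _ PM] _] := mP.
by have := PM c x; rewrite cx0 => /(_ (ideal0 idP))[/(Rc P mP)|].
Qed.

End NoetherianRing.

(** * Integral closure through multipliers *)

Section IntegralClosure.
Variable R : comPzRingType.
Implicit Types (I J L : set R) (c x y : R).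

(** The degree d of the integral equation serves as k: multiply the equation by
    x^n and use induction on n. The terms with i > n are in I^i, which
    is already small enough. *)
Lemma integral_closure_exp I x : integral_closure I x ->
  exists k, forall n, ideal_exp I n (x ^+ (n + k)).
Proof.
case=> d d_gt0 [a Ia /eqP]; rewrite addr_eq0 => /eqP xd; exists d.
elim/ltn_ind => n IHn; rewrite exprD xd mulrN mulr_sumr.
apply: idealN => //; rewrite big_seq; apply: ideal_sum => // i.
rewrite mem_index_iota => /andP[i_gt0 i_led]; rewrite mulrCA -exprD.
have Iai : ideal_exp I i (a i) by apply: Ia; rewrite i_gt0.
have [lein|ltni] := leqP i n; last first.
  by apply: idealMr => //; apply: ideal_exp_mono Iai; apply: ltnW.
have -> : (n + (d - i) = n - i + d)%N by lia.
rewrite -{1}(subnKC lein); apply: ideal_expD => //.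
by apply: IHn; lia.
Qed.

(** The elements a_1 x^(d-1) + ... + a_d with a_i in I^i: x is integral over I
    exactly when this ideal contains x^d for some positive d. *)
Definition lower_terms I x d : set R :=
  ideal_gen [set y | exists i a,
    [/\ (0 < i <= d)%N, ideal_exp I i a & y = a * x ^+ (d - i)]].

Lemma lower_terms_ideal I x d : is_ideal (lower_terms I x d).
Proof. exact: ideal_gen_ideal. Qed.
Local Hint Resolve lower_terms_ideal : core.

Lemma mem_lower_terms I x d i a :
  (0 < i <= d)%N -> ideal_exp I i a -> lower_terms I x d (a * x ^+ (d - i)).
Proof. by move=> id Ia; apply: ideal_gen_sub; exists i, a. Qed.

Lemma lower_terms_sum I x d y : lower_terms I x d y ->
  exists2 a : nat -> R, forall i, (1 <= i <= d)%N -> ideal_exp I i (a i) &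
    y = \sum_(1 <= i < d.+1) a i * x ^+ (d - i).
Proof.
move: y; apply: ideal_gen_ind => [|_ [i [a [id Ia ->]]]].
  split=> [|y z [a Ia ->] [b Ib ->]|r y [a Ia ->]].
  - exists (fun=> 0) => [i _|]; first exact: ideal0.
    by rewrite big1 // => i _; rewrite mul0r.
  - exists (fun i => a i + b i) => [i id|]; first by apply: idealD => //; auto.
    by rewrite -big_split; apply: eq_bigr => i _; rewrite mulrDl.
  - exists (fun i => r * a i) => [i id|]; first by apply: idealMl => //; auto.
    by rewrite mulr_sumr; apply: eq_bigr => i _; rewrite mulrA.
exists (fun j => if j == i then a else 0) => [j _|].
  by case: eqP => [->//|_]; apply: ideal0.
rewrite (bigD1_seq i) ?iota_uniq ?mem_index_iota //= eqxx.
by rewrite big1 ?addr0 // => j /negPf->; rewrite mul0r.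
Qed.

Lemma lower_termsMX I x d e y :
  lower_terms I x d y -> lower_terms I x (d + e) (y * x ^+ e).
Proof.
move: y; apply: ideal_gen_ind => [|_ [i [a [/andP[i0 id] Ia ->]]]].
  exact: ideal_preimr.
have -> : a * x ^+ (d - i) * x ^+ e = a * x ^+ (d + e - i).
  by rewrite -mulrA -exprD; congr (_ * _ ^+ _); lia.
by apply: mem_lower_terms => //; lia.
Qed.

Lemma lower_termsM I x d e y z :
  lower_terms I x d y -> lower_terms I x e z -> lower_terms I x (d + e) (y * z).
Proof.
move=> + Lz; move: y; apply: ideal_gen_ind => [|_ [i [a [/andP[i0 id] Ia ->]]]].
  exact: ideal_preimr.
move: z Lz; apply: ideal_gen_ind => [|_ [j [b [/andP[j0 je] Ib ->]]]].
  exact: ideal_preim.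
have -> : a * x ^+ (d - i) * (b * x ^+ (e - j)) =
    a * b * x ^+ (d + e - (i + j)).
  by rewrite mulrACA -exprD; congr (_ * _ ^+ _); lia.
by apply: mem_lower_terms; [lia|apply: ideal_expD].
Qed.

(** The step multiplies F^m and F: all summands of
    x^(d+e) - F G = (x^d - F) x^e + (x^e - G) x^d - (x^d - F)(x^e - G)
    consist of lower terms when x^d - F and x^e - G do. *)
Lemma lower_terms_power I x d F m : lower_terms I x d (x ^+ d - F) ->
  lower_terms I x (m * d) (x ^+ (m * d) - F ^+ m).
Proof.
move=> LF; elim: m => [|m IHm].
  by rewrite mul0n !expr0 subrr; apply: ideal0; apply: lower_terms_ideal.
have idL := lower_terms_ideal I x (d + m * d).
have -> : x ^+ (m.+1 * d) - F ^+ m.+1 = (x ^+ d - F) * x ^+ (m * d) +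
    (x ^+ (m * d) - F ^+ m) * x ^+ d
    - (x ^+ d - F) * (x ^+ (m * d) - F ^+ m).
  by rewrite mulSn exprD exprS; ring.
rewrite mulSn; apply: (idealD idL); first apply: (idealD idL).
- exact: lower_termsMX.
- by rewrite addnC; apply: lower_termsMX.
- by apply: (idealN idL); apply: lower_termsM.
Qed.

Lemma lower_terms_integral I x d :
  (0 < d)%N -> lower_terms I x d (x ^+ d) -> integral_closure I x.
Proof.
move=> d0 /lower_terms_sum[a Ia xd]; exists d => //; exists (fun i => - a i).
  by move=> i id; apply: idealN => //; apply: Ia.
rewrite xd -big_split big1 //= => i _.
by rewrite mulNr subrr.
Qed.

Lemma sub_integral_closure I : I `<=` integral_closure I.
Proof.
move=> x Ix; exists 1%N => //; exists (fun=> - x).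
  by move=> [|[|]] // _; exact: idealN (ideal_exp1 Ix).
by rewrite big_nat1 expr1 subnn expr0 mulr1 subrr.
Qed.

Section Multipliers.
Hypothesis hR : noetherian R.

(** The converse of [integral_multiplier]: the dependence relation of the
    sequence c x^n reads c (x^d - lower terms) = 0, and a multiplier c in R° can
    be cancelled up to nilpotents, so that a power of x^d - lower terms is
    an equation of integral dependence. *)
Lemma multiplier_integral I c x N : is_ideal I -> Rcirc R c ->
  (forall n, (N <= n)%N -> ideal_exp I n (c * x ^+ n)) -> integral_closure I x.
Proof.
move=> idI Rc Icx.
(* Starting at N + 1 rather than N makes the degree d below positive. *)
have [|n [g Ig cxn]] := @power_dependence _ hR I N.+1
    (fun n => c * x ^+ (N.+1 + n)) idI.
  by move=> n; apply: Icx; lia.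
pose d := (N.+1 + n)%N; pose F := x ^+ d - \sum_(i < n) g i * x ^+ (N.+1 + i).
have LF : lower_terms I x d (x ^+ d - F).
  rewrite /F opprB addrC subrK; apply: ideal_sum => // i _.
  have -> : (N.+1 + i = d - (n - i))%N by rewrite /d; have := ltn_ord i; lia.
  by apply: mem_lower_terms; [rewrite /d; have := ltn_ord i; lia|apply: Ig].
have [m Fm0] : exists m, F ^+ m = 0.
  apply: (Rcirc_cancel hR Rc); rewrite mulrBr cxn mulr_sumr.
  by apply/eqP; rewrite subr_eq0; apply/eqP/eq_bigr => i _; rewrite mulrCA.
apply: (@lower_terms_integral _ _ (m.+1 * d)); first by rewrite /d; lia.
by have := lower_terms_power (m := m.+1) LF; rewrite [F ^+ _]exprS Fm0 mulr0 subr0.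
Qed.

Variable I : set R.
Hypotheses (idI : is_ideal I) (htI : positive_height I).

Lemma integral_multiplier x : integral_closure I x ->
  exists2 c, Rcirc R c & forall n, ideal_exp I n (c * x ^+ n).
Proof.
move=> /integral_closure_exp[k Ixk].
have [c Ic Rc] := positive_height_Rcirc hR idI htI.
exists (c ^+ k) => [|n]; first exact: RcircX.
have [lekn|ltnk] := leqP k n.
  rewrite -{1}(subnKC lekn); apply: ideal_expD; first exact: mem_ideal_exp.
  by have := Ixk (n - k)%N; rewrite subnK.
apply: idealMr => //; apply: (ideal_exp_mono (ltnW ltnk)).
exact: mem_ideal_exp.
Qed.

(** Products of multipliers are multipliers of sums, by the binomial formula;
    this avoids any manipulation of integral equations. *)
Lemma integral_closure_ideal : is_ideal (integral_closure I).
Proof.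
split.
- by apply: sub_integral_closure; apply: ideal0.
- move=> x y /integral_multiplier[c Rc Icx] /integral_multiplier[d Rd Idy].
  apply: (@multiplier_integral _ (c * d) _ 0) => // [|n _]; first exact: RcircM.
  rewrite exprDn mulr_sumr; apply: ideal_sum => // i _.
  have -> : c * d * (x ^+ (n - i) * y ^+ i *+ 'C(n, i)) =
      'C(n, i)%:R * (c * x ^+ (n - i) * (d * y ^+ i)).
    by rewrite -[_ *+ 'C(n, i)]mulr_natl; ring.
  apply: idealMl => //; have lein : (i <= n)%N by rewrite -ltnS.
  by rewrite -{1}(subnK lein); apply: ideal_expD.
- move=> a x /integral_multiplier[c Rc Icx].
  apply: (@multiplier_integral _ c _ 0) => // n _.
  by rewrite exprMn mulrCA; apply: idealMl.
Qed.

(** Grouping the letters of a word turns it into a monomial in the elements of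
    s, and the product of the multipliers of these elements works for all the
    monomials. *)
Lemma word_multiplier (s : seq R) :
  (forall a, a \in s -> integral_closure I a) ->
  exists2 c, Rcirc R c & forall w : seq R, {subset w <= s} ->
    ideal_exp I (size w) (c * \prod_(b <- w) b).
Proof.
elim: s => [_|a s IHs sI].
  exists 1 => [|[|b w] sw]; [exact: Rcirc1|by []|].
  by have := sw b (mem_head _ _).
have [c Rc Icw] := IHs (fun b bs => sI b (mem_behead (s := a :: s) bs)).
have [d Rd Ida] := integral_multiplier (sI a (mem_head _ _)).
exists (d * c) => [|w sw]; first exact: RcircM.
have [k [v [vs wE pE]]] : exists k v, [/\ {subset v <= s},
    size w = (k + size v)%N & \prod_(b <- w) b = a ^+ k * \prod_(b <- v) b].
  elim: w sw => [_|b w IHw sw].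
    by exists 0%N, [::]; split=> //; rewrite big_nil mulr1.
  have [e ew|k [v [vs wE pE]]] := IHw; first by apply: sw; rewrite inE ew orbT.
  rewrite big_cons pE /= wE.
  have := sw b (mem_head _ _); rewrite inE => /predU1P[->|bs].
    by exists k.+1, v; split=> //; rewrite exprS mulrA.
  exists k, (b :: v); split; rewrite ?big_cons ?addnS ?(mulrCA b) //.
  by move=> e; rewrite inE => /predU1P[->|/vs].
rewrite wE pE mulrACA; apply: ideal_expD; [exact: Ida|exact: Icw].
Qed.

(** L^n is generated by the words of length n in generators of L. The induction
    peels off the factors of L^n one by one and stores them in a word w. *)
Lemma uniform_multiplier L : is_ideal L -> L `<=` integral_closure I ->
  exists2 c, Rcirc R c & forall n y, ideal_exp L n y -> ideal_exp I n (c * y).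
Proof.
move=> idL LI; have [s sE] := hR idL.
have [a sa|c Rc Icw] := @word_multiplier s.
  by apply: LI; rewrite sE; apply: ideal_gen_sub.
have Lw n y w : ideal_exp L n y -> {subset w <= s} ->
    ideal_exp I (n + size w) (c * (y * \prod_(b <- w) b)).
  move=> + ws; elim: n y w ws => [|n IHn] y w ws.
    by move=> _; rewrite mulrCA; apply: idealMl => //; apply: Icw.
  have idIp u : is_ideal [set x | ideal_exp I (n.+1 + size w) (c * (x * u))].
    exact (ideal_preimr u (ideal_preim c (ideal_exp_ideal I (n.+1 + size w)))).
  move: y; apply: ideal_mul_ind => [|x y Lx Ly]; first exact: idIp.
  rewrite -mulrA; move: x Lx; rewrite sE.
  apply: ideal_gen_ind => [|a /= sa]; first exact: idIp.
  have aws : {subset a :: w <= s} by move=> b; rewrite inE => /predU1P[->|/ws].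
  by have := IHn y (a :: w) aws Ly; rewrite big_cons /= addnS [y * _]mulrCA.
exists c => // n y Ly; have nil_s : {subset [::] <= s} by [].
by have := Lw n y [::] Ly nil_s; rewrite big_nil mulr1 addn0.
Qed.

End Multipliers.
End IntegralClosure.

(** * Hara-Yoshida closures *)

Section HaraYoshida.
Variables (R : comPzRingType) (K : realType).
Hypothesis hR : noetherian R.
Variables I aa : set R.
Hypotheses (idI : is_ideal I) (idaa : is_ideal aa).
Hypotheses (htI : positive_height I) (htaa : positive_height aa).
Implicit Types (t : K) (x y : R).

Lemma absz_ceil_nat m : `|Num.ceil (m%:R : K)|%N = m.
Proof. by rewrite -[m%:R]/((Posz m)%:~R) intrKceil. Qed.

Lemma absz_ceil_shift t n : 1 < t ->
  `|Num.ceil (t * n%:R)|%N = (n + `|Num.ceil ((t - 1) * n%:R)|)%N.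
Proof.
move=> t1; have -> : t * n%:R = (t - 1) * n%:R + (Posz n)%:~R.
  by rewrite -pmulrn; ring.
rewrite ceilDrz ?intr_int // intrKceil.
have : 0 <= Num.ceil ((t - 1) * n%:R).
  rewrite ceil_ge0; apply: (lt_le_trans (ltrN10 _)).
  by rewrite mulr_ge0 // subr_ge0 ltW.
by case: (Num.ceil _) => // k _; rewrite -PoszD addnC.
Qed.

(** The harder inclusion is from right to left: the definition of the closure
    asks for a multiplier that is uniform over x^n aa^(mn), which sits in
    the n-th power of the ideal L = x aa^m of integral elements. *)
Lemma HY_closure_nat m :
  HY_closure aa (m%:R : K) I = ideal_colon (integral_closure I) (ideal_exp aa m).
Proof.
have ceilm n : `|Num.ceil (m%:R * n%:R : K)|%N = (m * n)%N.
  by rewrite -natrM absz_ceil_nat.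
apply/seteqP; split=> x.
  move=> [c Rc [N Icx]] y ay.
  apply: (multiplier_integral hR (N := N) idI Rc) => n Nn.
  rewrite exprMn mulrA; apply: Icx => //; rewrite ceilm.
  exact: ideal_expX.
move=> Ix; pose L := ideal_gen [set x * y | y in ideal_exp aa m].
have idL : is_ideal L := ideal_gen_ideal _.
have LI : L `<=` integral_closure I.
  apply: ideal_gen_ind => [|_ [y ay <-]]; last exact: Ix.
  exact: integral_closure_ideal.
have Lx n z : ideal_exp aa (m * n) z -> ideal_exp L n (x ^+ n * z).
  elim: n z => [//|n IHn] z; rewrite mulnS => /ideal_exp_split.
  move: z; apply: ideal_mul_ind => [|y z ay /IHn Lz]; first exact: ideal_preim.
  rewrite exprS mulrACA; apply: mem_ideal_mul => //.
  by apply: ideal_gen_sub; exists y.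
have [c Rc cL] := uniform_multiplier hR idI htI idL LI.
exists c => //; exists 0%N => n _ y; rewrite ceilm => /Lx/cL.
by rewrite mulrA.
Qed.

Lemma HY_closure_colon t : 1 < t ->
  HY_closure aa t I `<=` ideal_colon (HY_closure aa (t - 1) I) aa.
Proof.
move=> t1 x [c Rc [N Icx]] y ay; exists c => //; exists N => n Nn z az.
have := Icx n Nn (y ^+ n * z); rewrite absz_ceil_shift //.
rewrite exprMn !mulrA; apply; apply: ideal_expD => //.
exact: mem_ideal_exp.
Qed.

Lemma principal_exp a n x :
  ideal_exp (ideal_gen [set a]) n x -> exists b, x = b * a ^+ n.
Proof.
elim: n x => [|n IHn] x; first by exists x; rewrite mulr1.
move: x; apply: ideal_mul_ind => [|x y /ideal_gen1[b ->] /IHn[d ->]].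
  split=> [|x y [b ->] [d ->]|r x [b ->]].
  - by exists 0; rewrite mul0r.
  - by exists (b + d); rewrite mulrDl.
  - by exists (r * b); rewrite mulrA.
by exists (b * d); rewrite exprS; ring.
Qed.

Lemma colon_HY_closure_principal t : 1 < t -> is_principal aa ->
  ideal_colon (HY_closure aa (t - 1) I) aa `<=` HY_closure aa t I.
Proof.
move=> t1 [a aaE] x Ix.
have [|c Rc [N Icx]] := Ix a; first by rewrite aaE; apply: ideal_gen_sub.
exists c => //; exists N => n Nn y; rewrite absz_ceil_shift // => /ideal_exp_split.
move: y; apply: ideal_mul_ind => [|y z]; first exact: ideal_preim.
rewrite {1}aaE => /principal_exp[b ->] /(Icx n Nn) Iz.
have -> : c * x ^+ n * (b * a ^+ n * z) = b * (c * (x * a) ^+ n * z).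
  by rewrite exprMn; ring.
exact: idealMl.
Qed.

Lemma colon_HY_closure_nat m :
  ideal_colon (HY_closure aa (m%:R : K) I) aa `<=` HY_closure aa (m.+1%:R : K) I.
Proof.
rewrite !HY_closure_nat => x Ix; apply: ideal_mul_ind => [|y z ay az].
  exact: ideal_preim (integral_closure_ideal hR idI htI).
by rewrite mulrA; apply: Ix.
Qed.

(** For y in the rational power, d y^(sq) is in aa^(rq) for a suitable d in R°,
    and rq = t (sq). So c d (x y)^(sq) lies in I^(sq) for large q, and a further
    factor a^s with a in I covers the exponents between multiples of s. *)
Lemma HY_closure_rational r s : (0 < s)%N ->
  HY_closure aa (r%:R / s%:R : K) I `<=`
  ideal_colon (integral_closure I) (rational_power aa r s).
Proof.
move=> s0 x [c Rc [N Icx]] y ay.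
have [a Ia Ra] := positive_height_Rcirc hR idI htI.
have htr : positive_height (ideal_exp aa r).
  have [b ab Rb] := positive_height_Rcirc hR idaa htaa.
  by move=> P mP rP; apply: (RcircX (n := r) Rb mP); apply/rP/mem_ideal_exp.
have [d Rd ady] := integral_multiplier hR (ideal_exp_ideal aa r) htr ay.
have expexp q z : ideal_exp (ideal_exp aa r) q z -> ideal_exp aa (r * q) z.
  elim: q z => [|q IHq] z; first by rewrite muln0.
  move: z; rewrite mulnS; apply: ideal_mul_ind => // u v au /IHq.
  exact: ideal_expD.
have Rm : Rcirc R (c * d * a ^+ s).
  by apply: RcircM; [apply: RcircM|apply: RcircX].
apply: (multiplier_integral hR (N := (s * N)%N) idI Rm) => n Nn.
pose q := (n %/ s)%N; have nE : n = (s * q + n %% s)%N.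
  by rewrite mulnC -divn_eq.
have qN : (N <= q)%N by rewrite leq_divRL // mulnC.
have Icq : ideal_exp I (s * q) (c * x ^+ (s * q) * (d * (y ^+ s) ^+ q)).
  apply: Icx; first by apply: leq_trans qN _; rewrite leq_pmull.
  have -> : (r%:R / s%:R * (s * q)%:R : K) = (r * q)%:R.
    by rewrite !natrM mulrA divfK // pnatr_eq0 -lt0n.
  by rewrite absz_ceil_nat; apply: expexp.
have -> : c * d * a ^+ s * (x * y) ^+ n = (x * y) ^+ (n %% s) *
    (c * x ^+ (s * q) * (d * (y ^+ s) ^+ q) * a ^+ s).
  by rewrite {1}nE exprD !exprMn -[(y ^+ s) ^+ q]exprM; ring.
apply: idealMl => //; apply: (@ideal_exp_mono _ _ _ (s * q + s)).
  by rewrite {1}nE leq_add2l ltnW // ltn_mod.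
by apply: ideal_expD => //; apply: mem_ideal_exp.
Qed.

Lemma rational_colon_HY_closure m r s : (r <= m * s)%N ->
  ideal_colon (integral_closure I) (rational_power aa r s)
    `<=` HY_closure aa (m%:R : K) I.
Proof.
move=> rms; rewrite HY_closure_nat => x Ix y ay; apply: Ix.
apply: sub_integral_closure; apply: (ideal_exp_mono rms).
exact: ideal_expX.
Qed.

End HaraYoshida.

Unset Implicit Arguments.

Theorem proposition3p5 (R : comPzRingType) (hR : noetherian R)
    (I aa : set R) (idI : is_ideal I) (idaa : is_ideal aa)
    (htI : positive_height I) (htaa : positive_height aa)
    (K : realType) (t : K) (t0 : 0 < t) :
  [/\ (1 < t ->
        HY_closure aa t I `<=` ideal_colon (HY_closure aa (t - 1) I) aa /\
        (is_principal aa \/ t \is a Num.int ->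
          HY_closure aa t I = ideal_colon (HY_closure aa (t - 1) I) aa)),
      (forall r s : nat, (0 < s)%N -> t = r%:R / s%:R ->
        HY_closure aa t I
          `<=` ideal_colon (integral_closure I) (rational_power aa r s) /\
        ideal_colon (integral_closure I) (rational_power aa r s)
          `<=` HY_closure aa ((Num.ceil t)%:~R : K) I)
    & (forall m : nat, (1 <= m)%N -> t = m%:R ->
        HY_closure aa t I = ideal_colon (integral_closure I) (ideal_exp aa m))].
Proof.
split=> [t1|r s s0 tE|m _ ->]; last exact: HY_closure_nat.
  split=> [|special]; first exact: HY_closure_colon.
  apply/seteqP; split; first exact: HY_closure_colon.
  case: special => [|t_int]; first exact: colon_HY_closure_principal.
  have [m tE] : exists m, t = m.+1%:R.
    move: t_int; rewrite intrEge0 ?ltW // => /natrP[[|m] tE]; last by exists m.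
    by move: t0; rewrite tE ltxx.
  have -> : t - 1 = m%:R by rewrite tE -addn1 natrD addrK.
  by rewrite tE; apply: colon_HY_closure_nat.
split; first by rewrite tE; apply: HY_closure_rational.
have ceilE : Num.ceil t = `|Num.ceil t|%N :> int.
  by rewrite gez0_abs // ltW // ceil_gt0.
rewrite ceilE; apply: rational_colon_HY_closure => //.
have : t <= (`|Num.ceil t|%N)%:R by have := ceil_ge t; rewrite ceilE.
by rewrite {1}tE ler_pdivrMr ?ltr0n // -natrM ler_nat.
Qed.
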